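(* Let $(\Gamma,M)$ be an E-GCM graph with index set $I_n$ whose associated Coxeter group $W$ is finite, with longest element $w_0$. Let $s_{i_l}\cdots s_{i_2}s_{i_1}$ be any reduced expression for $w_0$, and for $1\le j\le l$ set $\beta_j:=s_{i_1}s_{i_2}\cdots s_{i_{j-1}}.\alpha_{i_j}$. Then the following are equivalent: (1) $(\Gamma,M)$ has no odd asymmetries; (2) each ON-connected component $(\Gamma',M')$ of $(\Gamma,M)$ is unital ON-cyclic with $f_{\Gamma',M'}=1$; (3) $\{\beta_j\}_{j=1}^l=\Phi_M^+$; (4) $\ell(w_0)=|\Phi_M^+|$; (5) each positive root $\alpha\in\Phi_M^+$ appears as the root functional $\phi_{\beta_j}$ at some node $\gamma_{i_j}$ for the game sequence $(\gamma_{i_1},\dots,\gamma_{i_l})$ played from any strongly dominant position (i.e. for each $\alpha\in\Phi_M^+$ there is $j$ with $\phi_\alpha=\phi_{\beta_j}$).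
   Context: Fix $n \ge 1$ and $I_n=\{1,\dots,n\}$. An E-GCM is a real $n\times n$ matrix $M=(M_{ij})$ with $M_{ii}=2$, $M_{ij}\le 0$ for $i\ne j$, $M_{ij}\neq 0$ iff $M_{ji}\ne 0$, and whenever $M_{ij}M_{ji}\neq 0$ either $M_{ij}M_{ji}\ge 4$ or $M_{ij}M_{ji}=4\cos^2(\pi/k)$ for some integer $k\ge 3$. The E-GCM graph has nodes $\gamma_i$, with $\gamma_i,\gamma_j$ ($i\ne j$) adjacent iff $M_{ij}\ne0$. Set $m_{ij}=k$ if $M_{ij}M_{ji}=4\cos^2(\pi/k)$ for an integer $k\ge2$, $m_{ij}=\infty$ if $M_{ij}M_{ji}\ge4$; $W$ is the Coxeter group with generators $s_i$, relations $s_i^2=1$, $(s_is_j)^{m_{ij}}=1$, length $\ell$. Geometric representation: $V$ has basis $(\alpha_i)$, bilinear form $B(\alpha_i,\alpha_j)=\tfrac12M_{ij}$, $s_i.v=v-2B(\alpha_i,v)\alpha_i$; roots $\Phi_M=\{w.\alpha_i\}$; $\Phi_M^+$ are roots with all coefficients $\ge0$. Positions $\lambda\in\mathbb{R}^n$ are identified with elements of $V^*$ via $\lambda_i=\langle\lambda,\alpha_i\rangle$; $\lambda$ is strongly dominant if all $\lambda_i>0$. Firing node $\gamma_i$ (allowed only if $\lambda_i>0$) replaces each $\lambda_j$ by $\lambda_j-M_{ij}\lambda_i$; a game sequence is the sequence of nodes fired when repeatedly firing nodes with positive numbers until none remain. For a root $\alpha$, the root functional $\phi_\alpha:V^*\to\mathbb{R}$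 is $\phi_\alpha(\mu)=\langle\mu,\alpha\rangle$; in the firing sequence $(\gamma_{i_1},\dots)$ from $\lambda$, the number at node $\gamma_{i_q}$ just before its firing equals $\phi_{\beta_q}(\lambda)$ with $\beta_q=s_{i_1}\cdots s_{i_{q-1}}.\alpha_{i_q}$, and $\phi_{\beta_q}$ is called the root functional at node $\gamma_{i_q}$. Two adjacent nodes $\gamma_i,\gamma_j$ form an odd asymmetry if $m_{ij}$ is odd and $M_{ij}\ne M_{ji}$. For $\alpha\in\Phi_M$, $\mathfrak{S}_M(\alpha):=\{K\alpha:K\in\mathbb{R}\}\cap\Phi_M^+$. For odd-neighborly nodes ($m_{ij}$ odd) set $K_{ji}:=-M_{ji}/(2\cos(\pi/m_{ij}))$. An ON-path is a sequence $[\gamma_{i_0},\dots,\gamma_{i_p}]$ with consecutive nodes odd-neighborly; $\Pi_{\mathcal P}:=K_{i_pi_{p-1}}\cdots K_{i_1i_0}$; an ON-cycle is an ON-path with equal start and end nodes. An ON-connected component is the induced E-GCM subgraph on a maximal set of nodes pairwise joined by ON-paths; it is unital ON-cyclic if $\Pi_{\mathcal C}=1$ for all its ON-cycles $\mathcal C$, in which case $|\mathfrak{S}_M(\alpha_x)|$ is finite and independent of the node $\gamma_x$ of the component, and is denoted $f_{\Gamma',M'}$. *)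

(* Defs.v *)
From HB Require Import structures.
From mathcomp Require Import all_boot all_order all_algebra.
From mathcomp Require Import boolp classical_sets functions cardinality.
From mathcomp Require Import reals trigo.

Set Implicit Arguments.
Unset Strict Implicit.
Unset Printing Implicit Defensive.

Import Order.TTheory GRing.Theory Num.Theory.

Local Open Scope quotient_scope.
Local Open Scope classical_set_scope.
Local Open Scope ring_scope.

(* The group presented by generators s_i and relations s_i^2 = 1 and
   (s_i s_j)^(m i j) = 1 for i <> j: words in the generators modulo the
   congruence generated by the relations. Since s_i^2 = 1, words without
   inverse letters suffice. m i j = 0 encodes an infinite exponent, for which
   the second relation is vacuous. *)
Section CoxeterGroup.
Variables (n : nat) (m : 'I_n -> 'I_n -> nat).

Inductive cox_congr : seq 'I_n -> seq 'I_n -> Prop :=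
| cox_congr_refl u : cox_congr u u
| cox_congr_sym u v : cox_congr u v -> cox_congr v u
| cox_congr_trans v u w : cox_congr u v -> cox_congr v w -> cox_congr u w
| cox_congr_cat u u' v v' :
    cox_congr u u' -> cox_congr v v' -> cox_congr (u ++ v) (u' ++ v')
| cox_congr_sq i : cox_congr [:: i; i] [::]
| cox_congr_braid i j :
    i != j -> cox_congr (flatten (nseq (m i j) [:: i; j])) [::].

Definition cox_rel : rel (seq 'I_n) := fun u v => `[< cox_congr u v >].

Lemma cox_rel_refl : reflexive cox_rel.
Proof. by move=> u; apply/asboolP; apply: cox_congr_refl. Qed.

Lemma cox_rel_sym : symmetric cox_rel.
Proof. by move=> u v; apply/asboolP/asboolP; apply: cox_congr_sym. Qed.

Lemma cox_rel_trans : transitive cox_rel.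
Proof.
move=> v u w /asboolP uv /asboolP vw; apply/asboolP.
exact: cox_congr_trans uv vw.
Qed.

Canonical cox_equiv := EquivRel cox_rel cox_rel_refl cox_rel_sym cox_rel_trans.

Definition coxeter_group : Type := {eq_quot cox_rel}.

HB.instance Definition _ := Choice.on coxeter_group.
HB.instance Definition _ := EqQuotient.on coxeter_group.

Definition cox_class (u : seq 'I_n) : coxeter_group := \pi_coxeter_group u.

Lemma cox_classP u v : cox_class u = cox_class v <-> cox_congr u v.
Proof.
split; first by move/eqmodP => /asboolP.
by move=> uv; apply/eqmodP/asboolP.
Qed.

Lemma cox_class_repr w : cox_class (repr w) = w.
Proof. exact: reprK. Qed.

Lemma cox_congr_repr u : cox_congr (repr (cox_class u)) u.
Proof. by apply/cox_classP; rewrite cox_class_repr. Qed.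

Definition cox_one : coxeter_group := cox_class [::].
Definition cox_mul (x y : coxeter_group) := cox_class (repr x ++ repr y).
Definition cox_inv (x : coxeter_group) := cox_class (rev (repr x)).

Lemma cox_mul_class u v : cox_mul (cox_class u) (cox_class v) = cox_class (u ++ v).
Proof. by apply/cox_classP; apply: cox_congr_cat; apply: cox_congr_repr. Qed.

Lemma cox_congr_rev u : cox_congr (rev u ++ u) [::].
Proof.
elim: u => [|i u IHu]; first exact: cox_congr_refl.
rewrite rev_cons cat_rcons; apply: cox_congr_trans IHu.
apply: cox_congr_cat; first exact: cox_congr_refl.
apply: (@cox_congr_cat [:: i; i] [::]); first exact: cox_congr_sq.
exact: cox_congr_refl.
Qed.

Lemma cox_mulA : associative cox_mul.
Proof.
move=> x y z; rewrite -(cox_class_repr x) -(cox_class_repr y).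
by rewrite -(cox_class_repr z) !cox_mul_class catA.
Qed.

Lemma cox_mul1 : left_id cox_one cox_mul.
Proof. by move=> x; rewrite -(cox_class_repr x) cox_mul_class. Qed.

Lemma cox_mulr1 : right_id cox_one cox_mul.
Proof. by move=> x; rewrite -(cox_class_repr x) cox_mul_class cats0. Qed.

Lemma cox_mulV : left_inverse cox_one cox_inv cox_mul.
Proof.
move=> x; rewrite -{2}(cox_class_repr x) cox_mul_class.
exact/cox_classP/cox_congr_rev.
Qed.

Lemma cox_mulrV : right_inverse cox_one cox_inv cox_mul.
Proof.
move=> x; rewrite -{1}(cox_class_repr x) cox_mul_class; apply/cox_classP.
by rewrite -{1}(revK (repr x)); apply: cox_congr_rev.
Qed.

HB.instance Definition _ := isGroup.Build coxeter_group
  cox_mulA cox_mul1 cox_mulr1 cox_mulV cox_mulrV.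

Definition cox_gen (i : 'I_n) : coxeter_group := cox_class [:: i].

Definition word_prod (u : seq 'I_n) : coxeter_group :=
  (\prod_(i <- u) cox_gen i)%g.

Lemma word_prodE u : word_prod u = cox_class u.
Proof.
rewrite /word_prod; elim: u => [|i u IHu]; first by rewrite big_nil.
by rewrite big_cons IHu; apply: cox_mul_class.
Qed.

Lemma cox_length_subproof (w : coxeter_group) :
  exists k, `[< exists u, word_prod u = w /\ size u = k >].
Proof.
exists (size (repr w)); apply/asboolP; exists (repr w).
by rewrite word_prodE cox_class_repr.
Qed.

Definition cox_length (w : coxeter_group) : nat := ex_minn (cox_length_subproof w).

Definition reduced_expression (u : seq 'I_n) (w : coxeter_group) : Prop :=
  word_prod u = w /\ size u = cox_length w.

Definition longest_element (w0 : coxeter_group) : Prop :=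
  forall w, (cox_length w <= cox_length w0)%N.

End CoxeterGroup.

Section EGCM.
Variables (R : realType) (n : nat).
Implicit Types (M : 'M[R]_n) (i j x y : 'I_n) (lam mu : 'rV[R]_n).

Record is_EGCM M : Prop := IsEGCM {
  egcm_diag : forall i, M i i = 2;
  egcm_offdiag : forall i j, i != j -> M i j <= 0;
  egcm_zero : forall i j, M i j != 0 <-> M j i != 0;
  egcm_prod : forall i j, M i j * M j i != 0 ->
    4 <= M i j * M j i \/
    exists k : nat, (3 <= k)%N /\ M i j * M j i = 4 * cos (pi / k%:R) ^+ 2 }.

(* The k in the definition is unique, by monotonicity of cos on [0, pi]; the
   value is 0, encoding infinity, when M i j * M j i >= 4 (in particular for
   i = j). *)
Definition cox_m M i j : nat :=
  xget 0%N [set k : nat |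
    (2 <= k)%N /\ M i j * M j i = 4 * cos (pi / k%:R) ^+ 2].

Definition EGCM_group M : groupType := coxeter_group (cox_m M).

Definition adjacent M i j : bool := (i != j) && (M i j != 0).

Definition odd_neighborly M i j : bool := adjacent M i j && odd (cox_m M i j).

Definition odd_asymmetry M i j : bool := odd_neighborly M i j && (M i j != M j i).

(* V is 'rV[R]_n with its standard basis. *)
Definition simple_root i : 'rV[R]_n := delta_mx 0 i.

Definition bform M (u v : 'rV[R]_n) : R := (u *m (2^-1 *: M) *m v^T) 0 0.

Definition reflection M i (v : 'rV[R]_n) : 'rV[R]_n :=
  v - (2 * bform M (simple_root i) v) *: simple_root i.

(* word_act M [:: i_1; ...; i_k] v = s_{i_1} ... s_{i_k}.v *)
Definition word_act M (u : seq 'I_n) (v : 'rV[R]_n) : 'rV[R]_n :=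
  foldr (reflection M) v u.

(* Every element of W is a product of generators, so letting u range over all
   words describes {w.alpha_i : w in W}. *)
Definition roots M : set 'rV[R]_n :=
  [set v | exists u i, v = word_act M u (simple_root i)].

Definition positive_roots M : set 'rV[R]_n :=
  [set v | roots M v /\ forall i, 0 <= v 0 i].

Definition proportional_roots M (v : 'rV[R]_n) : set 'rV[R]_n :=
  [set c *: v | c in [set: R]] `&` positive_roots M.

(* Positions are the coordinate vectors of elements of V^* in the basis dual to
   the simple roots. *)
Definition pairing lam (v : 'rV[R]_n) : R := \sum_i lam 0 i * v 0 i.

Definition root_functional (v : 'rV[R]_n) : 'rV[R]_n -> R :=
  fun mu => pairing mu v.

Definition strongly_dominant lam : Prop := forall i, 0 < lam 0 i.

Definition fire M i lam : 'rV[R]_n := \row_j (lam 0 j - M i j * lam 0 i).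

Fixpoint game_sequence M lam (s : seq 'I_n) : Prop :=
  if s is i :: s' then 0 < lam 0 i /\ game_sequence M (fire M i lam) s'
  else forall i, lam 0 i <= 0.

Definition beta M l (s : l.-tuple 'I_n) (j : 'I_l) : 'rV[R]_n :=
  word_act M (take j s) (simple_root (tnth s j)).

Lemma pairing_fire M i lam (v : 'rV[R]_n) :
  pairing (fire M i lam) v = pairing lam (reflection M i v).
Proof.
have Bi : 2 * bform M (simple_root i) v = \sum_j M i j * v 0 j.
  rewrite /bform /simple_root -rowE mxE mulr_sumr; apply: eq_bigr => j _.
  by rewrite !mxE !mulrA mulfV ?mul1r // pnatr_eq0.
rewrite /pairing /reflection Bi.
under [RHS]eq_bigr => j _ do rewrite !mxE eqxx /= mulrBr.
rewrite sumrB [X in _ = _ - X](bigD1 i) //= eqxx mulr1.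
rewrite [X in _ - (_ + X)]big1 ?addr0; last first.
  by move=> j /negPf ->; rewrite !mulr0.
rewrite mulr_sumr -sumrB; apply: eq_bigr => j _.
by rewrite mxE mulrBl mulrA (mulrC (M i j)).
Qed.

Lemma pairing_simple_root lam i : pairing lam (simple_root i) = lam 0 i.
Proof.
rewrite /pairing (bigD1 i) //= big1 ?addr0 => [|j /negPf ji].
  by rewrite mxE !eqxx mulr1.
by rewrite mxE ji andbF mulr0.
Qed.

(* The number at the j-th fired node, just before its firing. *)
Lemma game_number M l (s : l.-tuple 'I_n) (j : 'I_l) lam :
  foldl (fun mu i => fire M i mu) lam (take j s) 0 (tnth s j) =
  root_functional (beta M s j) lam.
Proof.
rewrite -pairing_simple_root /root_functional /beta.
elim: (take j s) lam => //= i u IHu lam.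
by rewrite IHu pairing_fire.
Qed.

Definition ON_factor M j i : R := - M j i / (2 * cos (pi / (cox_m M i j)%:R)).

(* The ON-path [x :: p], of length possibly 0. *)
Definition ON_path M x (p : seq 'I_n) : bool := path (odd_neighborly M) x p.

Fixpoint ON_prod M x (p : seq 'I_n) : R :=
  if p is y :: p' then ON_prod M y p' * ON_factor M y x else 1.

Definition ON_joined M x y : Prop := exists p, ON_path M x p /\ last x p = y.

Definition ON_pairwise_joined M (C : {set 'I_n}) : Prop :=
  forall x y, x \in C -> y \in C -> ON_joined M x y.

Definition ON_component M (C : {set 'I_n}) : Prop :=
  ON_pairwise_joined M C /\
  forall D : {set 'I_n}, C \subset D -> ON_pairwise_joined M D -> D = C.

Definition unital_ON_cyclic M (C : {set 'I_n}) : Prop :=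
  forall x p, all (mem C) (x :: p) -> ON_path M x p -> last x p = x ->
    ON_prod M x p = 1.

(* The common cardinality of the sets proportional_roots M (simple_root x), for
   x in C, when it exists; the default value 0 is never that cardinality for C
   nonempty, since simple_root x is in its own set. *)
Definition ON_f M (C : {set 'I_n}) : nat :=
  xget 0%N [set k : nat |
    forall x, x \in C -> (proportional_roots M (simple_root x) #= `I_k)%card].

End EGCM.

(* Main.v *)
Require Import Defs.
From mathcomp Require Import all_boot all_order all_algebra.
From mathcomp Require Import boolp classical_sets functions cardinality.
From mathcomp Require Import reals trigo.
From mathcomp Require Import ring lra zify.

(** The sign of [w.alpha_s] detects whether [l(w s) > l(w)], so every root is
    nonnegative or nonpositive. As [w0] negates every simple root, a positive
    root changes sign at some letter [i_j] of the reduced word, where it must be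
    a positive multiple of [alpha_(i_j)]; hence every positive root is a positive
    multiple of some [beta_j], while distinct [beta_j] are never proportional.
    All five conditions thus say that no simple root has another positive
    multiple among the roots.

    An odd asymmetry gives such a multiple inside the rank two subsystem: the
    alternating word of length [m - 1] sends [alpha_i] to [K_ji alpha_j].
    Conversely, if [w.alpha_i = a alpha_x], then [s_i] and [s_x] are conjugate,
    so the linear character of [W] equal to [-1] exactly on the ON-component of
    [x] shows that [i] lies in it. Without odd asymmetries [alpha_i] is then in
    the orbit of [alpha_x], so [a] is an eigenvalue of an element of [W], and
    [a = 1] by finiteness. *)

Set Implicit Arguments.
Unset Strict Implicit.
Unset Printing Implicit Defensive.

Import Order.TTheory GRing.Theory Num.Theory.

Local Open Scope classical_set_scope.
Local Open Scope ring_scope.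

(** * Alternating words in two letters *)

Section AlternatingWords.
Variable T : Type.
Implicit Types s t : T.

(** Built leftwards, so that the last letter is always [t]: acting on [alpha s], the word begins
    with the reflection in [t]. *)
Fixpoint alt_word s t k : seq T :=
  if k is k'.+1 then (if odd k' then s else t) :: alt_word s t k' else [::].

Lemma size_alt_word s t k : size (alt_word s t k) = k.
Proof. by elim: k => //= k ->. Qed.

Lemma alt_wordSr s t k : alt_word s t k.+1 = rcons (alt_word t s k) t.
Proof.
elim: k => // k IHk; rewrite [LHS]/= -/(alt_word s t k.+1) IHk /=.
by case: (odd k).
Qed.

Lemma alt_word_suffix s t a b :
  exists2 q, alt_word s t (a + b) = q ++ alt_word s t b & size q = a.
Proof.
elim: a => [|a [q eq szq]]; first by exists [::].
by exists ((if odd (a + b) then s else t) :: q); rewrite /= ?eq ?szq.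
Qed.

Lemma alt_word_double s t m :
  alt_word s t m.*2 = flatten (nseq m [:: s; t]).
Proof. by elim: m => //= m ->; rewrite odd_double. Qed.

(** Turns the relation $(st)^m = 1$ into the equality of the two alternating words of length $m$. *)
Lemma rev_alt_word_cat s t m :
  rev (alt_word t s m) ++ alt_word s t m = flatten (nseq m [:: s; t]).
Proof.
have shift x y k : y :: flatten (nseq k [:: x; y]) =
    rcons (flatten (nseq k [:: y; x])) y.
  by elim: k => //= k ->.
elim: m s t => // m IHm s t.
by rewrite !alt_wordSr rev_rcons cat_cons -rcons_cat IHm /= shift.
Qed.

End AlternatingWords.

(** * Length and parity in the Coxeter group, on words *)

Section CoxeterLength.
Variables (n : nat) (m : 'I_n -> 'I_n -> nat).
Implicit Types (u v w : seq 'I_n) (i j : 'I_n).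

Definition word_length u : nat := cox_length (cox_class m u).

Lemma word_length_congr u v : cox_congr m u v -> word_length u = word_length v.
Proof. by rewrite /word_length => /cox_classP ->. Qed.

Lemma word_length_size u : (word_length u <= size u)%N.
Proof.
rewrite /word_length /cox_length; case: ex_minnP => k _; apply.
by apply/asboolP; exists u; rewrite word_prodE.
Qed.

Lemma word_length_ex u : exists2 v, cox_congr m u v & size v = word_length u.
Proof.
rewrite /word_length /cox_length; case: ex_minnP => k /asboolP[v [vu <-]] _.
by exists v => //; apply/cox_classP; rewrite -vu word_prodE.
Qed.

Lemma cox_congr_cat2l w u v : cox_congr m u v -> cox_congr m (w ++ u) (w ++ v).
Proof. by apply: cox_congr_cat; apply: cox_congr_refl. Qed.

Lemma cox_congr_cat2r w u v : cox_congr m u v -> cox_congr m (u ++ w) (v ++ w).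
Proof. by move=> uv; apply: cox_congr_cat uv _; apply: cox_congr_refl. Qed.

Lemma word_length_cat u v : (word_length (u ++ v) <= word_length u + size v)%N.
Proof.
have [u' uu' <-] := word_length_ex u.
rewrite (word_length_congr (cox_congr_cat2r v uu')) -size_cat.
exact: word_length_size.
Qed.

Lemma word_length_catl u v : (word_length (u ++ v) <= size u + word_length v)%N.
Proof.
have [v' vv' <-] := word_length_ex v.
rewrite (word_length_congr (cox_congr_cat2l u vv')) -size_cat.
exact: word_length_size.
Qed.

Lemma cox_congr_ii u i : cox_congr m ((u ++ [:: i]) ++ [:: i]) u.
Proof.
rewrite -catA -[X in cox_congr m _ X]cats0; apply: cox_congr_cat2l.
exact: cox_congr_sq.
Qed.

Lemma cox_congr_rev_hom u v : cox_congr m u v -> cox_congr m (rev u) (rev v).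
Proof.
move=> uv.
(* the class of [rev u] is the inverse of the class of [u] *)
apply: cox_congr_trans (_ : cox_congr m (rev u ++ v ++ rev v) _).
  apply: cox_congr_sym; rewrite -[X in cox_congr m _ X]cats0.
  apply: cox_congr_cat2l.
  by rewrite -{1}[v]revK; apply: cox_congr_rev.
rewrite catA -[X in cox_congr m _ X]cat0s; apply: cox_congr_cat2r.
apply: cox_congr_trans (cox_congr_rev m u).
exact/cox_congr_cat2l/cox_congr_sym.
Qed.

Lemma word_length_rev u : word_length (rev u) = word_length u.
Proof.
have le w : (word_length (rev w) <= word_length w)%N.
  have [v wv <-] := word_length_ex w.
  rewrite (word_length_congr (cox_congr_rev_hom wv)) -size_rev.
  exact: word_length_size.
by apply/eqP; rewrite eqn_leq le -{1}[u]revK le.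
Qed.

Lemma cox_congr_braid_alt i j : i != j ->
  cox_congr m (alt_word i j (m i j)) (alt_word j i (m i j)).
Proof.
move=> ij; set a := alt_word i j _; set b := alt_word j i _.
have ba : cox_congr m (rev b ++ a) [::].
  by rewrite rev_alt_word_cat; apply: cox_congr_braid.
apply: cox_congr_trans (_ : cox_congr m (b ++ rev b ++ a) _).
  rewrite catA -[X in cox_congr m X]cat0s; apply/cox_congr_sym/cox_congr_cat2r.
  by rewrite -{1}[b]revK; apply: cox_congr_rev.
by rewrite -[X in cox_congr m _ X]cats0; apply: cox_congr_cat2l.
Qed.

(* The linear characters of W: sign -1 on a union of classes of simple
   reflections, +1 on the others. *)
Lemma cox_congr_odd_count (C : pred 'I_n) u v :
    (forall i j, i != j -> odd (m i j) -> C i = C j) ->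
  cox_congr m u v -> odd (count C u) = odd (count C v).
Proof.
move=> Codd; elim => {u v} //.
- by move=> v u w _ -> _ ->.
- by move=> u u' v v' _ + _; rewrite !count_cat !oddD => -> ->.
- by move=> i /=; rewrite addn0 addnn odd_double.
- move=> i j ij.
  have -> k : odd (count C (flatten (nseq k [:: i; j]))) =
      odd k && (C i (+) C j).
    elim: k => //= k IHk; rewrite !oddD IHk !oddb.
    by case: (C i); case: (C j); case: (odd k).
  by case: (boolP (odd _)) => // /(Codd _ _ ij) ->; rewrite addbb.
Qed.

(** The sign character, with value $-1$ on every generator. *)
Lemma odd_word_length u : odd (word_length u) = odd (size u).
Proof.
have [v uv <-] := word_length_ex u.
by rewrite -!count_predT; apply/esym/(cox_congr_odd_count _ uv).
Qed.

Lemma word_length_rcons_neq u i : word_length (u ++ [:: i]) != word_length u.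
Proof.
apply/eqP => /(congr1 odd); rewrite !odd_word_length size_cat addn1 /=.
by case: odd.
Qed.

End CoxeterLength.

(** * Chebyshev polynomials as coefficients of dihedral orbits *)

Section Chebyshev.
Variable R : realType.
Implicit Types (c x : R).

(* Chebyshev polynomials of the second kind, in the normalisation
   [chebU (2 cos x) k = sin (k x) / sin x]. *)
Fixpoint chebU c k : R :=
  if k is k'.+1 then
    if k' is k''.+1 then c * chebU c k' - chebU c k'' else 1
  else 0.

Lemma chebUSS c k : chebU c k.+2 = c * chebU c k.+1 - chebU c k.
Proof. by []. Qed.

Lemma chebU_ge0 c k : 2 <= c -> 0 <= chebU c k.
Proof.
(* Monotonicity is carried along because the recurrence contains a subtraction. *)
move=> c2; suff: 0 <= chebU c k <= chebU c k.+1 by case/andP.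
elim: k => [|k /andP[U0 U1]]; first by rewrite lexx ler01.
by rewrite chebUSS; apply/andP; split; nra.
Qed.

Lemma chebU_sin x k : chebU (2 * cos x) k * sin x = sin (k%:R * x).
Proof.
suff [] : chebU (2 * cos x) k * sin x = sin (k%:R * x) /\
    chebU (2 * cos x) k.+1 * sin x = sin (k.+1%:R * x) by [].
elim: k => [|k [IH0 IH1]]; first by rewrite !mul0r sin0 !mul1r.
split=> //; rewrite chebUSS mulrBl -(mulrA (2 * cos x)) IH1 IH0.
rewrite -(natr1 k.+1) -(natr1 k) !(mulrDl _ _ x) mul1r !sinD !cosD.
set S := sin (_ * x); set C := cos (_ * x); apply/eqP; rewrite -subr_eq0.
have -> : 2 * cos x * (S * cos x + C * sin x) - S - ((S * cos x + C * sin x) *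
    cos x + (C * cos x - S * sin x) * sin x) =
    S * (cos x ^+ 2 + sin x ^+ 2 - 1) by ring.
by rewrite cos2Dsin2 subrr mulr0.
Qed.

Section RootOfUnity.
Variable m : nat.
Hypothesis m_gt1 : (1 < m)%N.
Let x : R := pi / m%:R.
Let c := 2 * cos x.

Let m_gt0 : 0 < m%:R :> R. Proof. by rewrite ltr0n; lia. Qed.
Let mx : m%:R * x = pi. Proof. by rewrite /x mulrC divfK ?gt_eqF. Qed.
Let x_gt0 : 0 < x. Proof. by rewrite divr_gt0 ?pi_gt0. Qed.

Lemma sin_pi_div_gt0 : 0 < sin x.
Proof.
apply: sin_gt0_pi; rewrite x_gt0 /= ltr_pdivrMr // ltr_pMr ?pi_gt0 //.
by rewrite ltr1n.
Qed.

Lemma cos_pi_div_ge0 : 0 <= cos x.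
Proof.
apply: cos_ge0_pihalf; have pi0 := pi_gt0 R; apply/andP; split.
  by apply: le_trans (ltW x_gt0); lra.
by rewrite ler_pM2l // lef_pV2 ?posrE // ler_nat.
Qed.

Lemma cos_pi_div_sqr_lt1 : cos x ^+ 2 < 1.
Proof. have := cos2Dsin2 x; have := sin_pi_div_gt0; nra. Qed.

Let chebUE k : chebU c k = sin (k%:R * x) / sin x.
Proof. by rewrite -chebU_sin mulfK // gt_eqF // sin_pi_div_gt0. Qed.

Lemma chebU_root_ge0 k : (k <= m)%N -> 0 <= chebU c k.
Proof.
move=> km; rewrite chebUE; apply: divr_ge0; last exact/ltW/sin_pi_div_gt0.
apply: sin_ge0_pi; rewrite mulr_ge0 ?ler0n ?(ltW x_gt0) //= -mx.
by rewrite ler_pM2r // ler_nat.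
Qed.

(** The values at $m-1$ and $m$ give the image of [alpha s] under the alternating word of length
    $m-1$; those at $2m$ and $2m+1$ show that $(st)^m$ fixes [alpha s]. *)
Lemma chebU_root : chebU c m = 0.
Proof. by rewrite chebUE mx sinpi mul0r. Qed.

Lemma chebU_root_pred : chebU c m.-1 = 1.
Proof.
rewrite chebUE -subn1 natrB ?(ltnW m_gt1) // mulrBl mx mul1r sinB sinpi cospi.
by rewrite mul0r sub0r mulN1r opprK divff // gt_eqF // sin_pi_div_gt0.
Qed.

Lemma chebU_root_double : chebU c m.*2 = 0.
Proof.
by rewrite chebUE -muln2 mulnC natrM -mulrA mx mulr_natl sin2pi mul0r.
Qed.

Lemma chebU_root_doubleS : chebU c m.*2.+1 = 1.
Proof.
rewrite chebUE -natr1 mulrDl mul1r -muln2 mulnC natrM -mulrA mx mulr_natl.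
by rewrite addrC sinD2pi divff // gt_eqF // sin_pi_div_gt0.
Qed.

End RootOfUnity.
End Chebyshev.

(** * The geometric representation and its dihedral subgroups *)

Section Reflections.
Variables (R : realType) (n : nat) (M : 'M[R]_n).
Implicit Types (u v : 'rV[R]_n) (p q : seq 'I_n) (i j s t x : 'I_n) (a c r : R).

Notation alpha := (@simple_root R n).
Notation roots := (@Defs.roots R n).

(* The functional $2B(\alpha_i, \cdot)$. *)
Definition coroot i v : R := \sum_j M i j * v 0 j.

Lemma reflectionE i v : reflection M i v = v - coroot i v *: alpha i.
Proof.
rewrite /reflection; congr (_ - _ *: _).
rewrite /bform /simple_root -rowE mxE mulr_sumr; apply: eq_bigr => j _.
by rewrite !mxE !mulrA mulfV ?mul1r // pnatr_eq0.
Qed.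

Lemma corootD i u v : coroot i (u + v) = coroot i u + coroot i v.
Proof. by rewrite -big_split; apply: eq_bigr => j _; rewrite mxE mulrDr. Qed.

Lemma corootZ i (a : R) v : coroot i (a *: v) = a * coroot i v.
Proof. by rewrite mulr_sumr; apply: eq_bigr => j _; rewrite mxE mulrCA. Qed.

Lemma simple_rootE i j : alpha i 0 j = (j == i)%:R.
Proof. by rewrite mxE eqxx. Qed.

Lemma coroot_simple i j : coroot i (alpha j) = M i j.
Proof.
rewrite /coroot (bigD1 j) //= simple_rootE eqxx mulr1 big1 ?addr0 // => k.
by rewrite simple_rootE => /negPf ->; rewrite mulr0.
Qed.

Lemma sum_simple_root v : v = \sum_i v 0 i *: alpha i.
Proof. exact: row_sum_delta. Qed.

Lemma reflectionD i u v :
  reflection M i (u + v) = reflection M i u + reflection M i v.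
Proof. by rewrite !reflectionE corootD scalerDl opprD addrACA. Qed.

Lemma reflectionZ i a v : reflection M i (a *: v) = a *: reflection M i v.
Proof. by rewrite !reflectionE corootZ scalerBr scalerA. Qed.

Lemma reflection_simple i j :
  reflection M i (alpha j) = alpha j - M i j *: alpha i.
Proof. by rewrite reflectionE coroot_simple. Qed.

Lemma word_act_cat p q v :
  word_act M (p ++ q) v = word_act M p (word_act M q v).
Proof. exact: foldr_cat. Qed.

Lemma word_actD p u v : word_act M p (u + v) = word_act M p u + word_act M p v.
Proof. by elim: p => //= i p ->; rewrite reflectionD. Qed.

Lemma word_actZ p a v : word_act M p (a *: v) = a *: word_act M p v.
Proof. by elim: p => //= i p ->; rewrite reflectionZ. Qed.

Lemma word_actN p v : word_act M p (- v) = - word_act M p v.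
Proof. by rewrite -scaleN1r word_actZ scaleN1r. Qed.

Lemma word_act_sum p v :
  word_act M p v = \sum_i v 0 i *: word_act M p (alpha i).
Proof.
have w0 : word_act M p 0 = 0 by have := word_actZ p 0 0; rewrite !scale0r.
rewrite {1}(sum_simple_root v) (big_morph _ (word_actD p) w0).
by apply: eq_bigr => i _; rewrite word_actZ.
Qed.

Hypothesis EGCM_M : is_EGCM M.

Lemma reflection_self i : reflection M i (alpha i) = - alpha i.
Proof.
rewrite reflection_simple egcm_diag //.
by rewrite scaler_nat mulr2n opprD addrA subrr sub0r.
Qed.

Lemma reflectionK i : involutive (reflection M i).
Proof.
move=> v; rewrite [X in reflection M i X]reflectionE -scaleNr reflectionD.
by rewrite reflectionZ reflection_self reflectionE scaleNr scalerN opprK addrNK.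
Qed.

Lemma word_actK p v : word_act M p (word_act M (rev p) v) = v.
Proof.
elim: p v => // i p IHp v.
by rewrite rev_cons -cats1 word_act_cat /= IHp reflectionK.
Qed.

Lemma word_act_revK p v : word_act M (rev p) (word_act M p v) = v.
Proof. by rewrite -{2}[p]revK word_actK. Qed.

Lemma cox_mC i j : cox_m M i j = cox_m M j i.
Proof. by rewrite /cox_m; congr xget; apply/funext => k; rewrite mulrC. Qed.

(** The default of [xget] is 0, so a positive value is a genuine exponent. *)
Lemma cox_m_spec i j : (0 < cox_m M i j)%N ->
  (1 < cox_m M i j)%N /\
  M i j * M j i = (2 * cos (pi / (cox_m M i j)%:R)) ^+ 2.
Proof.
rewrite /cox_m; case: xgetP => [k _ [k2 Mk] _|//]; split=> //.
by rewrite Mk exprMn -natrX.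
Qed.

Lemma cox_m_eq0 i j : i != j -> cox_m M i j = 0%N -> 4 <= M i j * M j i.
Proof.
move=> ij m0.
have none k : (2 <= k)%N -> M i j * M j i <> 4 * cos (pi / k%:R) ^+ 2.
  move=> k2 Mk; suff: (2 <= cox_m M i j)%N by rewrite m0.
  by rewrite /cox_m; case: xgetP => [_ _ [] //|/(_ k)[]].
(* A zero product is the case $k = 2$, since $\cos(\pi/2) = 0$. *)
have [Mij0|] := eqVneq (M i j * M j i) 0.
  by case: (none 2%N) => //; rewrite Mij0 cos_pihalf expr2 mul0r mulr0.
move/(egcm_prod EGCM_M) => [//|[k [k3 Mk]]].
by case: (none k) => //; lia.
Qed.

(* [c] is [sqrt (M s t * M t s)] and [r] is the paper's [K_ts], but for all
   values of [m s t]; [r = 0] when [M s t = M t s = 0]. *)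
Lemma dihedral_params s t : s != t ->
  exists c r : R, [/\ 0 <= r, - M t s = r * c, - M s t * r = c,
    (0 < cox_m M s t)%N -> c = 2 * cos (pi / (cox_m M s t)%:R) &
    cox_m M s t = 0%N -> 2 <= c].
Proof.
move=> st; have a0 := egcm_offdiag EGCM_M st.
have b0 : M t s <= 0 by apply: egcm_offdiag => //; rewrite eq_sym.
have ab0 : M s t = 0 -> M t s = 0.
  by move=> /eqP Mst; apply/eqP; apply: contraTT Mst => /(egcm_zero EGCM_M).
have [c [c0 cE cm cm0]] : exists c, [/\ 0 <= c, M s t * M t s = c ^+ 2,
    (0 < cox_m M s t)%N -> c = 2 * cos (pi / (cox_m M s t)%:R) &
    cox_m M s t = 0%N -> 2 <= c].
  have [m0|m0] := posnP (cox_m M s t).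
    exists (Num.sqrt (M s t * M t s)).
    have le4 := cox_m_eq0 st m0.
    split=> [||| _]; first exact: sqrtr_ge0.
    - by rewrite sqr_sqrtr //; lra.
    - by rewrite m0.
    rewrite -(@ler_pXn2r _ 2) ?nnegrE ?sqrtr_ge0 //.
    by rewrite sqr_sqrtr ?(le_trans _ le4) //; lra.
  have [m1 mE] := cox_m_spec m0.
  exists (2 * cos (pi / (cox_m M s t)%:R)); split=> //; last by lia.
  by rewrite mulr_ge0 ?cos_pi_div_ge0.
exists c, (- M t s / c); have [c00|cN0] := eqVneq c 0.
  have Mst0 : M s t = 0.
    have [//|Mst] := eqVneq (M s t) 0.
    have := Mst; rewrite (egcm_zero EGCM_M) => Mts.
    by move/eqP: cE; rewrite c00 expr2 mulr0 mulf_eq0 (negPf Mst) (negPf Mts).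
  rewrite (ab0 Mst0) Mst0 c00 !oppr0 !mul0r; split=> //; rewrite -c00 //.
split=> //; first by rewrite divr_ge0 ?oppr_ge0.
  by rewrite divfK.
by rewrite mulrA mulrNN cE expr2 mulfK.
Qed.

(** In terms of [alpha s] and [r *: alpha t] both reflections have the same off-diagonal coefficient
    $c$, so each letter performs one step of the Chebyshev recurrence. *)
Lemma word_act_alt s t c r k :
    - M t s = r * c -> - M s t * r = c ->
  word_act M (alt_word s t k) (alpha s) =
  if odd k then chebU c k *: alpha s + (r * chebU c k.+1) *: alpha t
  else chebU c k.+1 *: alpha s + (r * chebU c k) *: alpha t.
Proof.
move=> Mts Mst; elim: k => [|k IHk].
  by rewrite /= scale1r mulr0 scale0r addr0.
rewrite [LHS]/= IHk [odd k.+1]/=; case: (odd k) => /=.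
  rewrite -/(chebU c k.+1) reflectionD !reflectionZ reflection_self.
  rewrite reflection_simple scalerBr scalerN scalerA addrCA [RHS]addrC.
  congr (_ + _).
  rewrite -opprD -scalerDl -scaleNr; congr (_ *: _).
  rewrite -/(chebU c k.+2) chebUSS; set U := chebU c k.+2.
  by rewrite -Mst; ring.
rewrite -/(chebU c k.+1) reflectionD !reflectionZ reflection_self.
rewrite reflection_simple scalerBr scalerN scalerA -addrA; congr (_ + _).
rewrite -opprD -scalerDl -scaleNr; congr (_ *: _).
by rewrite -/(chebU c k.+1) mulrBr mulrA -Mts; ring.
Qed.

Lemma word_act_braid s t : s != t -> forall v,
  word_act M (flatten (nseq (cox_m M s t) [:: s; t])) v = v.
Proof.
move=> st v; have [->//|m0] := posnP (cox_m M s t).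
have [m1 mE] := cox_m_spec m0.
have fix_first x y : x != y -> (0 < cox_m M x y)%N ->
    word_act M (flatten (nseq (cox_m M x y) [:: x; y])) (alpha x) = alpha x.
  move=> xy mxy; have [c [r [_ h1 h2 /(_ mxy) cE _]]] := dihedral_params xy.
  have [m1' _] := cox_m_spec mxy.
  rewrite -alt_word_double (word_act_alt _ h1 h2) odd_double.
  rewrite cE chebU_root_double ?chebU_root_doubleS //.
  by rewrite scale1r mulr0 scale0r addr0.
set p := flatten _.
have fs : word_act M p (alpha s) = alpha s by apply: fix_first.
have ft : word_act M p (alpha t) = alpha t.
  (* $(ts)^m$ fixes [alpha t], and $(st)^m$ is its inverse. *)
  have := fix_first t s; rewrite (cox_mC t s) eq_sym => /(_ st m0) fts.
  rewrite -{1}fts -word_act_cat /p.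
  have -> : flatten (nseq (cox_m M s t) [:: s; t]) =
      rev (flatten (nseq (cox_m M s t) [:: t; s])).
    by rewrite -!rev_alt_word_cat rev_cat revK.
  by rewrite word_act_cat word_act_revK.
(* the plane spanned by [alpha s], [alpha t] has a complement fixed by both *)
have d0 : 4 - M s t * M t s != 0.
  rewrite mE gt_eqF // subr_gt0 exprMn -natrX.
  have := @cos_pi_div_sqr_lt1 R _ m1; lra.
(* Cramer's rule for the two equations making both coroots vanish on [v']; the determinant is
   nonzero because $\cos^2(\pi/m) < 1$. *)
pose x := (2 * coroot s v - M s t * coroot t v) / (4 - M s t * M t s).
pose y := (2 * coroot t v - M t s * coroot s v) / (4 - M s t * M t s).
pose v' := v - x *: alpha s - y *: alpha t.
have vE : v = v' + (x *: alpha s + y *: alpha t).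
  by rewrite /v' -[v - _ - _]addrA -opprD addrNK.
have cv i : coroot i v' = coroot i v - x * M i s - y * M i t.
  by rewrite /v' -!scaleNr !corootD !corootZ !coroot_simple !mulNr.
have cs : coroot s v' = 0.
  by rewrite cv (egcm_diag EGCM_M) /x /y; field.
have ct : coroot t v' = 0.
  by rewrite cv (egcm_diag EGCM_M) /x /y; field.
have fv' : word_act M p v' = v'.
  rewrite /p; elim: (cox_m M s t) => //= k ->.
  rewrite [in reflection M t _]reflectionE ct scale0r subr0.
  by rewrite reflectionE cs scale0r subr0.
by rewrite {1}vE word_actD fv' word_actD !word_actZ fs ft -vE.
Qed.

(** Each defining relation acts trivially, so the action of words descends to $W$. *)
Lemma word_act_congr p q : cox_congr (cox_m M) p q ->
  forall v, word_act M p v = word_act M q v.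
Proof.
elim=> {p q}.
- by [].
- by move=> p q _ pq v; rewrite pq.
- by move=> q p r _ pq _ qr v; rewrite pq qr.
- by move=> p p' q q' _ pp' _ qq' v; rewrite !word_act_cat pp' qq'.
- by move=> i v; apply: reflectionK.
- by move=> i j ij v; apply: word_act_braid.
Qed.

Definition nneg v := forall i, 0 <= v 0 i.

Lemma nnegD u v : nneg u -> nneg v -> nneg (u + v).
Proof. by move=> u0 v0 i; rewrite mxE addr_ge0. Qed.

Lemma nnegZ a v : 0 <= a -> nneg v -> nneg (a *: v).
Proof. by move=> a0 v0 i; rewrite mxE mulr_ge0. Qed.

Lemma nneg_simple_root i : nneg (alpha i).
Proof. by move=> j; rewrite simple_rootE ler0n. Qed.

Lemma npos_word_act p v : (forall i, nneg (- word_act M p (alpha i))) ->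
  nneg v -> nneg (- word_act M p v).
Proof.
move=> p0 v0; rewrite word_act_sum -sumrN; apply: big_ind => [i||i _].
- by rewrite mxE.
- exact: nnegD.
- by rewrite -scalerN; apply: nnegZ.
Qed.

Lemma nneg_antisym v : nneg v -> nneg (- v) -> v = 0.
Proof.
move=> v0 vN; apply/rowP => i; apply/eqP.
rewrite [X in _ == X]mxE eq_le v0 andbT.
by have := vN i; rewrite mxE oppr_ge0.
Qed.

(** * Descents and the signs of roots *)

Notation len := (word_length (cox_m M)).
Notation congr_M := (cox_congr (cox_m M)).

(* Factor [p] as [q] times the longest possible alternating word in [s] and
   [t], where [t] is a right descent of [p]. Then neither [s] nor [t] is a right
   descent of [q], and the alternating word is shorter than [m s t]. *)
Lemma dihedral_factorization p s t : s != t ->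
    (len p < len (p ++ [:: s]))%N -> (len (p ++ [:: t]) < len p)%N ->
  exists q k, [/\ congr_M p (q ++ alt_word s t k), (len q < len p)%N,
    (len q < len (q ++ [:: s]))%N, (len q < len (q ++ [:: t]))%N &
    (0 < cox_m M s t)%N -> (k < cox_m M s t)%N].
Proof.
move=> st ps pt.
pose P k := exists q, congr_M p (q ++ alt_word s t k) /\ (len q + k = len p)%N.
have P1 : P 1%N.
  exists (p ++ [:: t]); split; first exact/cox_congr_sym/cox_congr_ii.
  have := word_length_cat (cox_m M) (p ++ [:: t]) [:: t].
  by rewrite (word_length_congr (cox_congr_ii _ p t)) /=; lia.
have exP : exists k, `[< P k >] by exists 1%N; apply/asboolP.
have ubP k : `[< P k >] -> (k <= len p)%N by move=> /asboolP[q [_ <-]]; lia.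
case: (ex_maxnP exP ubP) => k /asboolP[q [pv vk]] maxk.
have k0 : (0 < k)%N by apply: maxk; apply/asboolP.
(* [prv] is the first letter of the alternating word and [nxt] the one that would extend it. A
   descent of [q] at [nxt] contradicts the maximality of [k]; a descent at [prv] makes [p] too
   short. *)
pose nxt := if odd k then s else t; pose prv := if odd k then t else s.
have ascent x : ~ (len (q ++ [:: x]) < len q)%N ->
    (len q < len (q ++ [:: x]))%N.
  by have := word_length_rcons_neq (cox_m M) q x; lia.
have vnxt : (len q < len (q ++ [:: nxt]))%N.
  apply: ascent => lt; suff /maxk : `[< P k.+1 >] by rewrite ltnn.
  apply/asboolP; exists (q ++ [:: nxt]).
  have pvk : congr_M p ((q ++ [:: nxt]) ++ alt_word s t k.+1).
    apply: cox_congr_trans pv _.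
    rewrite /= -/nxt -(cat1s nxt (alt_word s t k)) catA; apply: cox_congr_cat2r.
    exact/cox_congr_sym/cox_congr_ii.
  split=> //.
  have := word_length_cat (cox_m M) (q ++ [:: nxt]) (alt_word s t k.+1).
  by rewrite -(word_length_congr pvk) size_alt_word; lia.
have vprv : (len q < len (q ++ [:: prv]))%N.
  apply: ascent => lt.
  have pvk : congr_M p ((q ++ [:: prv]) ++ alt_word s t k.-1).
    apply: cox_congr_trans pv _; rewrite /prv -(prednK k0) /= if_neg -catA.
    exact: cox_congr_refl.
  have := word_length_cat (cox_m M) (q ++ [:: prv]) (alt_word s t k.-1).
  by rewrite -(word_length_congr pvk) size_alt_word; lia.
exists q, k; split=> //.
- by lia.
- by move: vnxt vprv; rewrite /nxt /prv; case: odd.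
- by move: vnxt vprv; rewrite /nxt /prv; case: odd.
move=> m0; rewrite ltnNge; apply/negP => mk.
(* If $k \ge m$, the braid relation makes the word end in [s], so appending [s] would shorten
   [p]. *)
have [q2 qE q2s] := alt_word_suffix s t (k - cox_m M s t) (cox_m M s t).
have E : congr_M (p ++ [:: s]) (q ++ q2 ++ alt_word s t (cox_m M s t).-1).
  apply: cox_congr_trans
    (_ : congr_M ((q ++ q2 ++ alt_word t s (cox_m M s t)) ++ [:: s]) _).
    apply: cox_congr_cat2r; apply: cox_congr_trans pv _.
    rewrite -{1}(subnK mk) qE; do 2!apply: cox_congr_cat2l.
    exact: cox_congr_braid_alt.
  rewrite -{1}(prednK m0) alt_wordSr -cats1 !catA.
  exact: cox_congr_ii.
have := word_length_cat (cox_m M) q (q2 ++ alt_word s t (cox_m M s t).-1).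
by rewrite -(word_length_congr E) size_cat size_alt_word q2s; lia.
Qed.

Lemma word_length_descent p : (0 < len p)%N ->
  exists t, (len (p ++ [:: t]) < len p)%N.
Proof.
have [q pq szq] := word_length_ex (cox_m M) p; rewrite -szq.
case/lastP: q pq szq => // q t pq szq _; exists t.
have /word_length_congr -> : congr_M (p ++ [:: t]) q.
  apply: cox_congr_trans (cox_congr_cat2r _ pq) _; rewrite -cats1.
  exact: cox_congr_ii.
by apply: leq_ltn_trans (word_length_size _ _) _; rewrite size_rcons.
Qed.

Lemma word_length_eq0 p : len p = 0%N -> congr_M p [::].
Proof. by have [q pq <-] := word_length_ex (cox_m M) p => /size0nil <-. Qed.

(** Induction on length. In the dihedral factorization the alternating word sends [alpha s] to a
    nonnegative combination of [alpha s] and [alpha t], and the shorter left factor ascends at both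
    letters. *)
Theorem nneg_word_act_simple p s :
  (len p < len (p ++ [:: s]))%N -> nneg (word_act M p (alpha s)).
Proof.
have [N] := ubnP (len p); elim: N p s => // N IHN p s ltN ps.
have [/word_length_eq0 p1|/word_length_descent[t pt]] := posnP (len p).
  by rewrite (word_act_congr p1); apply: nneg_simple_root.
have st : s != t by apply: contraTneq pt => <-; rewrite -leqNgt ltnW.
have [v [k [pv vp vs vt km]]] := dihedral_factorization st ps pt.
have [c [r [r0 h1 h2 cm cm0]]] := dihedral_params st.
(* For finite $m$, $k < m$ keeps the index at most $m$, where the sine quotient is nonnegative;
   otherwise $c \ge 2$. *)
have U0 b : (b <= k.+1)%N -> 0 <= chebU c b.
  move=> bk; have [m0|m0] := posnP (cox_m M s t).
    exact/chebU_ge0/cm0.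
  have [m1 _] := cox_m_spec m0.
  by rewrite cm // chebU_root_ge0 //; have := km m0; lia.
rewrite (word_act_congr pv) word_act_cat (word_act_alt _ h1 h2).
have pos a b : 0 <= a -> 0 <= b ->
    nneg (word_act M v (a *: alpha s + b *: alpha t)).
  move=> a0 b0; rewrite word_actD !word_actZ.
  by apply: nnegD; apply: nnegZ => //; apply: IHN => //; lia.
by case: odd; apply: pos; rewrite ?mulr_ge0 ?U0.
Qed.

Lemma npos_word_act_simple p s :
  (len (p ++ [:: s]) < len p)%N -> nneg (- word_act M p (alpha s)).
Proof.
move=> ps; have := @nneg_word_act_simple (p ++ [:: s]) s.
rewrite (word_length_congr (cox_congr_ii _ p s)) => /(_ ps).
by rewrite word_act_cat /= reflection_self word_actN.
Qed.

Lemma root_nneg_or_npos v : roots M v -> nneg v \/ nneg (- v).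
Proof.
move=> [p [i ->]]; have := word_length_rcons_neq (cox_m M) p i.
rewrite neq_ltn => /orP[/npos_word_act_simple|/nneg_word_act_simple].
  by right.
by left.
Qed.

Lemma simple_root_neq0 i : alpha i != 0.
Proof.
apply/eqP => /rowP/(_ i) /eqP; rewrite simple_rootE eqxx mxE.
by rewrite oner_eq0.
Qed.

Lemma word_act_eq0 p v : word_act M p v = 0 -> v = 0.
Proof.
move=> pv; rewrite -(word_act_revK p v) pv.
by have := word_actZ (rev p) 0 0; rewrite !scale0r.
Qed.

Lemma roots_neq0 v : roots M v -> v != 0.
Proof.
move=> [p [i ->]]; apply/eqP => /word_act_eq0/eqP.
by rewrite (negPf (simple_root_neq0 i)).
Qed.

Lemma roots_word_act p v : roots M v -> roots M (word_act M p v).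
Proof. by move=> [q [i ->]]; exists (p ++ q), i; rewrite word_act_cat. Qed.

Lemma roots_simple i : roots M (alpha i).
Proof. by exists [::], i. Qed.

Lemma positive_roots_simple i : positive_roots M (alpha i).
Proof. by split; [apply: roots_simple | apply: nneg_simple_root]. Qed.

(* A reflection changes only one coordinate. *)
Lemma nneg_reflection_npos v i : v != 0 -> nneg v ->
  nneg (- reflection M i v) -> exists2 a, 0 < a & v = a *: alpha i.
Proof.
move=> v_neq0 v0 rv0; have vE : v = v 0 i *: alpha i.
  apply/rowP => j; rewrite mxE simple_rootE.
  have [->|ji] := eqVneq j i; first by rewrite mulr1.
  apply/eqP; rewrite mulr0 eq_le v0 andbT.
  have := rv0 j; rewrite reflectionE !mxE (negPf ji) andbF.
  by rewrite mulr0 subr0 oppr_ge0.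
exists (v 0 i) => //; rewrite lt_def v0 andbT.
by apply: contraNneq v_neq0 => vi0; rewrite vE vi0 scale0r.
Qed.

(** The letters of [p] act on [v] from the leftmost on; where the sign first changes, the current
    root is a positive multiple of that letter's simple root. *)
Lemma npos_word_act_factor p v : roots M v -> nneg v ->
    nneg (- word_act M (rev p) v) ->
  exists p1 i p2, p = p1 ++ i :: p2 /\
    exists2 a, 0 < a & v = a *: word_act M p1 (alpha i).
Proof.
elim: p v => [|i p IHp] v rv v0.
  by move=> /(nneg_antisym v0)/eqP; rewrite (negPf (roots_neq0 rv)).
rewrite rev_cons -cats1 word_act_cat /= => pv0.
have riv : roots M (reflection M i v) by apply: (@roots_word_act [:: i]).
have [iv0|iv0] := root_nneg_or_npos riv.
  have [p1 [j [p2 [-> [a a0 va]]]]] := IHp _ riv iv0 pv0.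
  exists (i :: p1), j, p2; split=> //; exists a => //.
  by rewrite /= -reflectionZ -va reflectionK.
have [a a0 va] := nneg_reflection_npos (roots_neq0 rv) v0 iv0.
by exists [::], i, p; split=> //; exists a.
Qed.

(** * Reduced words and conjugate simple reflections *)

Definition reduced p : bool := len p == size p.

Lemma reduced_infix p q q' : reduced (p ++ q ++ q') -> reduced q.
Proof.
rewrite /reduced !size_cat => /eqP red; rewrite eqn_leq word_length_size /=.
have := word_length_catl (cox_m M) p (q ++ q').
by rewrite red; have := word_length_cat (cox_m M) q q'; lia.
Qed.

Lemma reduced_prefix p q : reduced (p ++ q) -> reduced p.
Proof. exact: (@reduced_infix [::]). Qed.

Lemma nneg_reduced_rcons p i :
  reduced (p ++ [:: i]) -> nneg (word_act M p (alpha i)).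
Proof.
move=> pi; apply: nneg_word_act_simple.
by rewrite (eqP pi) (eqP (reduced_prefix pi)) size_cat addn1.
Qed.

(** Cancelling [p] and then $s_i$ would equate $-\alpha_i$ with a positive multiple of $q.\alpha_j$,
    which is nonnegative. *)
Lemma reduced_roots_neq p i q j a : 0 < a -> reduced (p ++ i :: q ++ [:: j]) ->
  word_act M p (alpha i) <> a *: word_act M (p ++ i :: q) (alpha j).
Proof.
move=> a0 red /(congr1 (word_act M (rev p))).
rewrite -word_actZ word_act_cat !word_act_revK /= => /(congr1 (reflection M i)).
rewrite reflectionK reflection_self => /rowP/(_ i).
rewrite word_actZ !mxE !eqxx /=.
have qj : reduced (q ++ [:: j]).
  by apply: (@reduced_infix (p ++ [:: i]) _ [::]); rewrite cats0 -catA.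
have := nneg_reduced_rcons qj i; nra.
Qed.

Lemma congr_nil_no_descent p :
  (forall i, ~ nneg (- word_act M p (alpha i))) -> congr_M p [::].
Proof.
move=> pN; apply: word_length_eq0; apply/eqP; rewrite -leqn0 leqNgt.
by apply/negP => /word_length_descent[i /npos_word_act_simple/pN].
Qed.

(* Proportional simple roots in one orbit have conjugate reflections: the
   product below acts by [v |-> v + g v *: alpha x] and so has no descents. *)
Lemma conj_simple_reflection p i x a :
  word_act M p (alpha i) = a *: alpha x ->
  congr_M ((p ++ i :: rev p) ++ [:: x]) [::].
Proof.
move=> pix; have a0 : a != 0.
  apply/eqP => a0; move: pix; rewrite a0 scale0r => /word_act_eq0/eqP.
  by rewrite (negPf (simple_root_neq0 i)).
have act v : exists g, word_act M (p ++ i :: rev p) v = v + g *: alpha x.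
  rewrite word_act_cat /= reflectionE -scaleNr word_actD word_actK word_actZ pix.
  by rewrite scalerA; eexists.
have actx : word_act M (p ++ i :: rev p) (alpha x) = - alpha x.
  have -> : alpha x = a^-1 *: word_act M p (alpha i).
    by rewrite pix scalerA mulVf // scale1r.
  rewrite word_actZ word_act_cat /= word_act_revK reflection_self word_actN.
  by rewrite scalerN.
apply: congr_nil_no_descent => j /(_ j).
(* The image of [alpha j] has $j$-th coordinate 1: two sign changes cancel for $j = x$, and
   otherwise only multiples of [alpha x] are added. *)
rewrite word_act_cat /=; have [->|jx] := eqVneq j x.
  rewrite reflection_self word_actN actx !mxE !eqxx /=; lra.
rewrite reflection_simple; have [g ->] := act (alpha j - M x j *: alpha x).
by rewrite !mxE !eqxx (negPf jx) /= !mulr0 subr0 addr0; lra.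
Qed.

(** * Odd neighbours, ON-components and proportional roots *)

Lemma odd_neighborlyC i j : odd_neighborly M i j = odd_neighborly M j i.
Proof.
rewrite /odd_neighborly /adjacent cox_mC eq_sym.
congr (_ && _ && _); apply/idP/idP; exact: (egcm_zero EGCM_M _ _).1.
Qed.

(** An odd exponent is at least 3, so $\cos(\pi/m) > 0$ and the matrix entry is nonzero. *)
Lemma odd_cox_m_neighborly i j :
  i != j -> odd (cox_m M i j) -> odd_neighborly M i j.
Proof.
move=> ij om; rewrite /odd_neighborly /adjacent ij om andbT /=.
have m0 : (0 < cox_m M i j)%N by case: (cox_m M i j) om.
have [m1 mE] := cox_m_spec m0; have m2 : (2 < cox_m M i j)%N.
  by case: (cox_m M i j) m1 om => [|[|[|k]]].
have pi0 := pi_gt0 R; suff: 0 < cos (pi / (cox_m M i j)%:R : R).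
  move=> cos_gt0; apply/eqP => Mij; move/esym/eqP: mE; rewrite Mij mul0r.
  by rewrite sqrf_eq0 mulf_eq0 pnatr_eq0 (gt_eqF cos_gt0).
apply: cos_gt0_pihalf; have m0R : 0 < (cox_m M i j)%:R :> R by rewrite ltr0n.
have := divr_gt0 pi0 m0R; rewrite ltr_pM2l // ltf_pV2 ?posrE // ltr_nat m2.
by lra.
Qed.

(** The relations between $r$ and $c$ give $M_{ts} = r^2 M_{st}$, so the positive ratio $r$ is 1
    exactly when the entries agree. *)
Lemma odd_neighborly_orbit s t : odd_neighborly M s t ->
  exists p r, [/\ 0 < r, word_act M p (alpha s) = r *: alpha t &
    (r == 1) = (M s t == M t s)].
Proof.
case/andP=> /andP[st Mst] om.
have m0 : (0 < cox_m M s t)%N by case: (cox_m M s t) om.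
have [m1 _] := cox_m_spec m0.
have Mts : M t s != 0 by apply/(egcm_zero EGCM_M).
have [c [r [r0 h1 h2 /(_ m0) cE _]]] := dihedral_params st.
have r_gt0 : 0 < r.
  rewrite lt_def r0 andbT; apply: contra_neq Mts => r00.
  by apply/eqP; rewrite -oppr_eq0 h1 r00 mul0r.
exists (alt_word s t (cox_m M s t).-1), r; split=> //.
  rewrite (word_act_alt _ h1 h2) (prednK m0).
  have -> : odd (cox_m M s t).-1 = false.
    by rewrite -(prednK m0) /= in om; case: odd om.
  by rewrite cE chebU_root // chebU_root_pred // scale0r add0r mulr1.
apply/eqP/eqP => [r1|Meq].
  by move: h1 h2; rewrite r1 mul1r mulr1 => <- /oppr_inj.
have : (r - 1) * ((r + 1) * M t s) = 0.
  have : - M t s = r * (- M s t * r) by rewrite h2.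
  by rewrite Meq; lra.
move/eqP; rewrite !mulf_eq0 (negPf Mts) orbF subr_eq0 => /orP[/eqP//|].
by rewrite gt_eqF //; lra.
Qed.

Lemma ON_joinedP i j :
  reflect (ON_joined M i j) (connect (odd_neighborly M) i j).
Proof.
by apply: (iffP connectP) => [[p pth ->]|[p [pth <-]]]; exists p.
Qed.

Lemma ON_connect_sym : connect_sym (odd_neighborly M).
Proof. exact/sym_connect_sym/odd_neighborlyC. Qed.

Lemma proportional_ON_connect p i x a : word_act M p (alpha i) = a *: alpha x ->
  connect (odd_neighborly M) x i.
Proof.
move=> /conj_simple_reflection H.
have Codd j k : j != k -> odd (cox_m M j k) ->
    connect (odd_neighborly M) x j = connect (odd_neighborly M) x k.
  move=> jk /(odd_cox_m_neighborly jk) /connect1.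
  by move/(same_connect_r ON_connect_sym)/(_ x).
(* Letters of [p] occur twice and [x] counts once, so an even total forces [i] into the
   component. *)
have := cox_congr_odd_count Codd H.
rewrite !count_cat /= count_rev addn0 connect0 !oddD.
by case: connect => //=; case: odd.
Qed.

Lemma ON_component_connect x :
  ON_component M [set y in connect (odd_neighborly M) x].
Proof.
split=> [y z|D sub joinD].
  rewrite !inE => xy xz; apply/ON_joinedP; apply: connect_trans xz.
  by rewrite ON_connect_sym.
apply/eqP; rewrite finset.eqEsubset sub andbT; apply/fintype.subsetP => y yD.
rewrite inE; apply/ON_joinedP/joinD => //; apply: (fintype.subsetP sub).
rewrite inE; apply: connect0.
Qed.

Section NoOddAsymmetry.
Hypothesis no_odd : ~ exists i j, odd_asymmetry M i j.

Let odd_symm i j : odd_neighborly M i j -> M i j = M j i.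
Proof.
move=> ij; apply/eqP/negPn/negP => Mij; apply: no_odd; exists i, j.
by rewrite /odd_asymmetry ij.
Qed.

Lemma ON_connect_orbit x y : connect (odd_neighborly M) x y ->
  exists p, word_act M p (alpha x) = alpha y.
Proof.
case/connectP=> q; elim: q x => [|z q IHq] x /=.
  by move=> _ ->; exists [::].
case/andP=> xz /IHq/[apply] -[p pE].
have [p' [r [_ p'E]]] := odd_neighborly_orbit xz.
rewrite (odd_symm xz) eqxx => /eqP r1.
by exists (p ++ p'); rewrite word_act_cat p'E r1 scale1r.
Qed.

(** By symmetry $-M_{xy}$ and $2\cos(\pi/m)$ are nonnegative with equal squares, so every factor is
    1. *)
Lemma ON_prod_eq1 x p : ON_path M x p -> ON_prod M x p = 1.
Proof.
elim: p x => //= y p IHp x /andP[xy /IHp ->]; rewrite mul1r /ON_factor.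
have Mxy := odd_symm xy; case/andP: xy => /andP[xy M0] om.
have m0 : (0 < cox_m M x y)%N by case: (cox_m M x y) om.
have [m1 mE] := cox_m_spec m0; have cos0 := cos_pi_div_ge0 R m1.
have Mle := egcm_offdiag EGCM_M xy; rewrite -Mxy.
set c := cos _ in mE cos0 *; move: mE; rewrite -Mxy => mE.
have <- : - M x y = 2 * c.
  apply/eqP; rewrite -(@eqrXn2 _ 2) ?oppr_ge0 ?mulr_ge0 //.
  by rewrite -mE sqrrN expr2.
by rewrite divff // oppr_eq0.
Qed.

End NoOddAsymmetry.

(* Otherwise the powers of [p] would be infinitely many elements of W. *)
Lemma finite_group_eigenvalue p v a : finite_set [set: EGCM_group M] ->
  v != 0 -> 0 < a -> word_act M p v = a *: v -> a = 1.
Proof.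
move=> finW v0 a0 pv; apply/eqP/negPn/negP => a1.
have pk k : word_act M (flatten (nseq k p)) v = a ^+ k *: v.
  elim: k => [|k IHk] /=; first by rewrite scale1r.
  by rewrite word_act_cat IHk word_actZ pv scalerA -exprSr.
pose f k : EGCM_group M := cox_class (cox_m M) (flatten (nseq k p)).
have f_inj : injective f.
  move=> k1 k2 /cox_classP /word_act_congr/(_ v); rewrite !pk => /eqP.
  rewrite -subr_eq0 -scalerBl scaler_eq0 (negPf v0) orbF subr_eq0 => /eqP.
  exact: ieexprIn.
apply: infinite_nat; have := @finite_preimage _ _ setT f (in2W f_inj) finW.
by rewrite preimage_setT.
Qed.

Lemma proportional_roots_simple x :
    ~ (exists i j, odd_asymmetry M i j) -> finite_set [set: EGCM_group M] ->
  proportional_roots M (alpha x) = [set alpha x]%classic.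
Proof.
move=> no_odd finW; apply/seteqP.
split=> [v [[a _ <-] [rv v0]]|v ->] /=; last first.
  by split; [exists 1; rewrite ?scale1r | apply: positive_roots_simple].
have a0 : 0 < a.
  rewrite lt_def; apply/andP; split.
    by have := roots_neq0 rv; rewrite scaler_eq0 negb_or => /andP[].
  by have := v0 x; rewrite !mxE !eqxx mulr1.
have [p [i pE]] := rv.
have [q qE] := ON_connect_orbit no_odd (proportional_ON_connect (esym pE)).
have -> : a = 1.
  apply: (finite_group_eigenvalue finW (simple_root_neq0 x) a0).
    by rewrite pE -qE -word_act_cat.
by rewrite scale1r.
Qed.

(** * Firing as the dual of reflecting *)

Lemma pairing_foldl_fire lam p v :
  pairing (foldl (fun mu i => fire M i mu) lam p) v =
  pairing lam (word_act M p v).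
Proof. by elim: p lam => //= i p IHp lam; rewrite IHp pairing_fire. Qed.

Lemma pairing_ge0 lam v : strongly_dominant lam -> nneg v -> 0 <= pairing lam v.
Proof. by move=> l0 v0; apply: sumr_ge0 => i _; rewrite mulr_ge0 // ltW. Qed.

Lemma pairing_gt0 lam v :
  strongly_dominant lam -> nneg v -> v != 0 -> 0 < pairing lam v.
Proof.
move=> l0 v0; rewrite lt_def pairing_ge0 // andbT; apply: contraNneq.
move=> /psumr_eq0P lv0; apply/eqP/rowP => i; rewrite [RHS]mxE; apply/eqP.
have /eqP := lv0 (fun i _ => mulr_ge0 (ltW (l0 i)) (v0 i)) i isT.
by rewrite mulf_eq0 gt_eqF.
Qed.

Lemma pairingN lam v : pairing lam (- v) = - pairing lam v.
Proof. by rewrite -sumrN; apply: eq_bigr => i _; rewrite mxE mulrN. Qed.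

Lemma root_functional_inj : injective (@root_functional R n).
Proof.
move=> u v uv; apply/rowP => k; have := congr1 (@^~ (alpha k)) uv.
have pairingC w : pairing (alpha k) w = pairing w (alpha k).
  by apply: eq_bigr => i _; rewrite mulrC.
by rewrite /root_functional !pairingC !pairing_simple_root.
Qed.

(** * Roots and games along a reduced word of maximal length *)

Section LongestWord.
Variables (l : nat) (s : l.-tuple 'I_n).
Hypothesis s_red : reduced s.
Hypothesis s_long : forall p, (len p <= l)%N.

Let len_s : len s = l. Proof. by rewrite (eqP s_red) size_tuple. Qed.

Lemma tuple_split (j : 'I_l) :
  s = take j s ++ tnth s j :: drop j.+1 s :> seq _.
Proof.
by rewrite (tnth_nth (tnth s j)) -drop_nth ?size_tuple // cat_take_drop.
Qed.

Lemma tuple_split2 (j k : 'I_l) : (j < k)%N -> exists q,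
  take k s = take j s ++ tnth s j :: q.
Proof.
move=> jk; exists (drop j.+1 (take k s)).
rewrite -(@take_takel _ j k) ?(ltnW jk) // (tnth_nth (tnth s j)).
rewrite -(@nth_take k _ (tnth s j) j jk) -drop_nth ?cat_take_drop //.
by rewrite size_takel // size_tuple ltnW.
Qed.

Lemma beta_nneg (j : 'I_l) : nneg (beta M s j).
Proof.
apply/nneg_reduced_rcons/(@reduced_prefix _ (drop j.+1 s)).
by rewrite -catA cat1s -tuple_split.
Qed.

Lemma beta_positive (j : 'I_l) : positive_roots M (beta M s j).
Proof. by split; [exists (take j s), (tnth s j) | apply: beta_nneg]. Qed.

Lemma beta_proportional (j k : 'I_l) a :
  0 < a -> beta M s j = a *: beta M s k -> j = k.
Proof.
have ltN (j' k' : 'I_l) b : (j' < k')%N -> 0 < b ->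
    beta M s j' <> b *: beta M s k'.
  move=> jk b0; rewrite /beta; have [q qE] := tuple_split2 jk; rewrite qE.
  apply: reduced_roots_neq b0 _; apply: (@reduced_prefix _ (drop k'.+1 s)).
  have := s_red; rewrite {1}(tuple_split k') qE -!catA.
  by rewrite /= -catA.
move=> a0 jk; have [||//] := ltngtP j k.
- by move=> lt; case: (ltN _ _ _ lt a0).
- move=> lt; case: (ltN _ _ a^-1 lt); rewrite ?invr_gt0 // jk scalerA.
  by rewrite mulVf ?gt_eqF // scale1r.
by move/val_inj.
Qed.

Lemma beta_inj : injective (beta M s).
Proof.
by move=> j k jk; apply: (@beta_proportional _ _ 1) => //; rewrite scale1r.
Qed.

Lemma npos_longest p i : len p = l -> nneg (- word_act M p (alpha i)).
Proof.
move=> lp; apply: npos_word_act_simple; rewrite ltn_neqAle.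
by rewrite word_length_rcons_neq lp s_long.
Qed.

(** The reverse of [s] has maximal length too, hence makes [v] nonpositive; [j] is the position
    where the sign changes. *)
Lemma positive_root_beta v : positive_roots M v ->
  exists j : 'I_l, exists2 a, 0 < a & v = a *: beta M s j.
Proof.
move=> [rv v0].
have pv0 : nneg (- word_act M (rev s) v).
  apply: npos_word_act => // i; apply: npos_longest.
  by rewrite word_length_rev len_s.
have [p1 [i [p2 [sE [a a0 vE]]]]] := npos_word_act_factor rv v0 pv0.
have jl : (size p1 < l)%N.
  by have := size_tuple s; rewrite sE size_cat /=; lia.
exists (Ordinal jl), a => //; rewrite vE /beta (tnth_nth i) /=.
by rewrite sE take_size_cat // nth_cat ltnn subnn.
Qed.

(** After firing a prefix [p], node [i] carries the value of [lam] at $p.\alpha_i$: a nonnegative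
    root while [p] followed by [i] is reduced, a nonpositive one at the end. *)
Lemma longest_game_sequence lam :
  strongly_dominant lam -> game_sequence M lam s.
Proof.
move=> lam0; suff game q p : p ++ q = s ->
    game_sequence M (foldl (fun mu i => fire M i mu) lam p) q.
  exact: (game s [::]).
elim: q p => [|i q IHq] p pE /=.
  move=> i; rewrite -pairing_simple_root pairing_foldl_fire -oppr_ge0 -pairingN.
  by apply: pairing_ge0 => //; apply: npos_longest; rewrite -(cats0 p) pE len_s.
split; last by have := IHq (rcons p i); rewrite foldl_rcons cat_rcons; apply.
rewrite -pairing_simple_root pairing_foldl_fire; apply: pairing_gt0 => //.
  apply/nneg_reduced_rcons/(@reduced_prefix _ q).
  by rewrite -catA cat1s pE.
by apply: roots_neq0; exists p, i.
Qed.

End LongestWord.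

End Reflections.

(** * The cycle of implications between the five conditions *)

Theorem theorem5p2 (R : realType) (n : nat) (n_gt0 : (1 <= n)%N)
    (M : 'M[R]_n) (EGCM_M : is_EGCM M)
    (finW : finite_set [set: EGCM_group M])
    (w0 : EGCM_group M) (w0_longest : longest_element w0)
    (l : nat) (s : l.-tuple 'I_n) (s_reduced : reduced_expression (rev s) w0) :
  [<-> (* 1 *) ~ (exists i j : 'I_n, odd_asymmetry M i j);
       (* 2 *) forall C : {set 'I_n}, ON_component M C ->
                 unital_ON_cyclic M C /\ ON_f M C = 1%N;
       (* 3 *) range (beta M s) = positive_roots M;
       (* 4 *) (positive_roots M #= `I_(cox_length w0))%card;
       (* 5 *) forall lam : 'rV[R]_n, strongly_dominant lam ->
                 game_sequence M lam s /\
                 forall alpha, positive_roots M alpha ->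
                   exists j : 'I_l,
                     root_functional alpha = root_functional (beta M s j)].
Proof.
have [w0E lE] := s_reduced; rewrite size_rev size_tuple in lE.
(* [s] spells the inverse of [w0], which has the same length. *)
have len_s : word_length (cox_m M) s = l.
  by rewrite -word_length_rev /word_length -word_prodE w0E -lE.
have s_red : reduced M s by rewrite /reduced len_s size_tuple.
have s_long p : (word_length (cox_m M) p <= l)%N by rewrite lE w0_longest.
have posB := beta_positive EGCM_M s_red.
have Bpos := positive_root_beta EGCM_M s_red s_long.
have Bprop := beta_proportional EGCM_M s_red.
have Binj := beta_inj EGCM_M s_red.
rewrite -lE; tfae.
- move=> no_odd C Ccomp.
  split; first by move=> x p _ pth _; apply: ON_prod_eq1.
  (* For empty [C] every number would satisfy the condition defining [ON_f]; maximality rules this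
     out, as a singleton is pairwise joined. *)
  have [x xC] : exists x, x \in C.
    apply/finset.set0Pn/eqP => C0; pose x := Ordinal n_gt0.
    have /finset.setP/(_ x) : [set x]%SET = C.
      apply: (Ccomp.2 [set x]%SET); first by rewrite C0 finset.sub0set.
      by move=> y z /finset.set1P-> /finset.set1P->; exists [::].
    by rewrite C0 !inE eqxx.
  have prop1 y : (proportional_roots M (simple_root R y) #= `I_1)%card.
    by rewrite proportional_roots_simple //; apply: card_set1.
  apply: xget_unique => [y _|k /(_ x xC) kE]; first exact: prop1.
  by apply/card_eq_II; rewrite -(card_eql kE) prop1.
- move=> unital; apply/seteqP; split=> [_ [j _ <-]//|v vpos].
  have [j [a a0 vE]] := Bpos v vpos.
  exists j => //; suff -> : v = beta M s j by [].
  (* Undoing the prefix before [j] carries [v] to [a *: alpha x], which must equal [alpha x] if that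
     ray holds one root. *)
  pose x := tnth s j; pose C := [set y in connect (odd_neighborly M) x]%SET.
  have [_ f1] := unital C (ON_component_connect EGCM_M x).
  have card1 : (proportional_roots M (simple_root R x) #= `I_1)%card.
    (* The value 1 differs from the default 0, so it is a true cardinality. *)
    move: f1; rewrite /ON_f; case: xgetP => // k -> + k1; rewrite k1.
    by apply; rewrite inE; apply: connect0.
  have [f [fI finj _]] := card_set_bijP card1.
  have propx : proportional_roots M (simple_root R x) (simple_root R x).
    by split; [exists 1; rewrite ?scale1r | apply: positive_roots_simple].
  have axE : a *: simple_root R x = word_act M (rev (take j s)) v.
    by rewrite vE /beta word_actZ word_act_revK.
  have propa : proportional_roots M (simple_root R x) (a *: simple_root R x).
    split; first by exists a.
    split; first by rewrite axE; apply: roots_word_act vpos.1.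
    exact: (nnegZ (ltW a0) (@nneg_simple_root R n _)).
  have ax1 : a *: simple_root R x = simple_root R x.
    apply: finj; rewrite ?inE //; have := fI _ propx; have := fI _ propa => /=.
    by case: (f _) => // + ; case: (f _).
  by rewrite vE /beta -word_actZ ax1.
- move=> <-; apply: card_eq_trans (card_esym card_II).
  by apply: inj_card_eq => j k _ _; apply: Binj.
- move=> cardP lam lam0; split; first exact: longest_game_sequence.
  move=> v vpos; have [f [fI finj _]] := card_set_bijP cardP.
  (* Pigeonhole: numbering the roots $\beta_j$ by [f] is an injective self-map of a finite set,
     hence onto. *)
  pose g (j : 'I_l) : 'I_l := Ordinal (fI _ (posB j)).
  have g_inj : injective g.
    by move=> j k [/finj]; rewrite !inE => /(_ (posB j) (posB k))/Binj.
  have [g' _ gK] := injF_bij g_inj.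
  pose j := g' (Ordinal (fI _ vpos)); exists j.
  have /(congr1 val)/= : g j = Ordinal (fI _ vpos) by rewrite gK.
  by move/finj; rewrite !inE => /(_ (posB j) vpos) ->.
- move=> game [i [j /andP[ij Mij]]].
  have lam0 : strongly_dominant (const_mx 1 : 'rV[R]_n).
    by move=> k; rewrite mxE ltr01.
  have [_ surj] := game _ lam0.
  (* Both [alpha j] and [r *: alpha j] are positive roots, hence of the form $\beta_k$; being
     proportional they coincide, so $r = 1$, against the asymmetry. *)
  have [p [r [r0 pE r1]]] := odd_neighborly_orbit EGCM_M ij.
  have [k /root_functional_inj kE] := surj _ (positive_roots_simple M j).
  have rpos : positive_roots M (r *: simple_root R j).
    by split; [exists p, i | exact: (nnegZ (ltW r0) (@nneg_simple_root R n _))].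
  have [k' /root_functional_inj k'E] := surj _ rpos.
  have kk' : k' = k by apply: (Bprop _ _ r r0); rewrite -kE -k'E.
  have : (r - 1) *: simple_root R j = 0.
    by rewrite scalerBl scale1r k'E kk' -kE subrr.
  move/eqP; rewrite scaler_eq0 (negPf (simple_root_neq0 R j)) orbF subr_eq0 r1.
  by rewrite (negPf Mij).
Qed.
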